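(* Let $\gamma\ge1$, $\mu>0$, $\mu_0>0$, $\sigma>0$, $B_1^*\ge0$ and $0<v_+\le1$, and let $\hat v$ be the corresponding gas-dynamical profile. Then every eigenvalue $\lambda\in\mathbb{C}$ with $\Re\lambda\ge0$ of the system $$\lambda w+w'-\frac{B_1^*\alpha'}{\mu_0\hat v}=\mu\frac{w''}{\hat v},\qquad \lambda\alpha+\alpha'-B_1^*w'=\frac{1}{\sigma\mu_0\hat v}\Big(\frac{\alpha'}{\hat v}\Big)'$$ satisfies $$\Re\lambda+|\Im\lambda|<\frac12\max\Big\{\frac1\mu,\mu_0\sigma\Big\}+(B_1^* )^2\sqrt{\frac{\sigma}{\mu\mu_0}}.$$
   Context: Set $\eta=-2\mu/3$ and $a=v_+^\gamma\frac{1-v_+}{1-v_+^\gamma}$. The profile $\hat v:\mathbb{R}\to[v_+,1]$ is the monotone decreasing solution, unique up to translation, of $(2\mu+\eta)\hat v'=\hat v\big(\hat v-1+a(\hat v^{-\gamma}-1)\big)$ with $\hat v(-\infty)=1$, $\hat v(+\infty)=v_+$ ($\hat v\equiv1$ if $v_+=1$). An eigenvalue is a $\lambda$ for which the system has a nontrivial complex-valued solution $(w,\alpha)$ on $\mathbb{R}$ that decays (with derivatives, exponentially; in particular lies in $H^2(\mathbb{R})$) as $x\to\pm\infty$. Here $'=d/dx$. *)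

(* Defs.v *)
From Stdlib Require Import Reals.
From Coquelicot Require Import Coquelicot.

Open Scope R_scope.

Definition eta (mu : R) : R := - 2 * mu / 3.

(* For [vp = 1] the quotient is [0 / 0]; [is_profile] does not use it there. *)
Definition a_coef (gamma vp : R) : R :=
  Rpower vp gamma * ((1 - vp) / (1 - Rpower vp gamma)).

(* The profile is only determined up to translation, hence a predicate. *)
Definition is_profile (gamma mu vp : R) (v : R -> R) : Prop :=
  (vp = 1 /\ forall x, v x = 1)
  \/
  (vp < 1
   /\ (forall x, vp <= v x <= 1)
   /\ (forall x y, x <= y -> v y <= v x)
   /\ (forall x, ex_derive v x)
   /\ (forall x, (2 * mu + eta mu) * Derive v x
                 = v x * (v x - 1
                          + a_coef gamma vp * (Rpower (v x) (- gamma) - 1)))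
   /\ is_lim v m_infty 1
   /\ is_lim v p_infty vp).

Definition is_derivative (f f' : R -> C) : Prop :=
  forall x : R, @is_derive R_AbsRing C_R_NormedModule f x (f' x).

(* For a continuous [f], a bound for all [x] is the same as a bound for
   large [|x|]. *)
Definition exp_decay (f : R -> C) : Prop :=
  exists K theta : R,
    0 < theta /\ forall x : R, Cmod (f x) <= K * exp (- theta * Rabs x).

Open Scope C_scope.

(* [w1], [w2] are w', w''; [al1], [al2] are alpha', alpha'';
   [q] is (alpha' / v)'. *)
Definition is_eigenfunction (mu mu0 sigma B : R) (v : R -> R) (lambda : C)
    (w al : R -> C) : Prop :=
  exists w1 w2 al1 al2 q : R -> C,
    is_derivative w w1 /\ is_derivative w1 w2
    /\ is_derivative al al1 /\ is_derivative al1 al2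
    /\ is_derivative (fun x => al1 x / v x) q
    /\ (forall x : R,
          lambda * w x + w1 x - B * al1 x / (mu0 * v x)
          = mu * (w2 x / v x))
    /\ (forall x : R,
          lambda * al x + al1 x - B * w1 x
          = 1 / (sigma * mu0 * v x) * q x)
    /\ exp_decay w /\ exp_decay w1 /\ exp_decay w2
    /\ exp_decay al /\ exp_decay al1 /\ exp_decay al2
    /\ (exists x : R, w x <> 0 \/ al x <> 0).

Definition is_eigenvalue (mu mu0 sigma B : R) (v : R -> R) (lambda : C)
    : Prop :=
  exists w al : R -> C, is_eigenfunction mu mu0 sigma B v lambda w al.

Close Scope C_scope.

(* Main.v *)
Require Import Defs.
From Stdlib Require Import Reals Lra.
From Coquelicot Require Import Coquelicot.

Open Scope R_scope.

(** Suppose [Re lambda + |Im lambda|] is at least the claimed bound. Put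
    [k = sqrt (sigma / (mu mu0))], let [s = 1] or [-1] be the sign of
    [Im lambda], and let [l z = Re z + s Im z]. The function
    [F = (mu l(w' conj w) - v |w|^2 / 2) / (mu k)
         + l((alpha' / v) conj alpha) / (sigma mu0) - v |alpha|^2 / 2]
    tends to 0 at both infinities. Since [v' <= 0] and [0 < v <= 1], completing
    squares shows that [F'] is at least a positive combination of
    [|mu w' + i s w|^2] and [|alpha' / (sigma mu0) + i s alpha|^2]. So [F] is
    monotone, hence zero, and the squares vanish. Then [|w|^2] and [|alpha|^2]
    are constant and tend to 0, so the eigenfunction is trivial. *)

(** * Real functions on the line that are bounded or tend to 0 at both infinities *)

Definition bounded (f : R -> R) : Prop :=
  exists K : R, forall x, Rabs (f x) <= K.

Definition vanishing (f : R -> R) : Prop :=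
  forall eps : R, 0 < eps ->
    exists N : R, forall x, N <= Rabs x -> Rabs (f x) <= eps.

Lemma bounded_mult (f g : R -> R) :
  bounded f -> bounded g -> bounded (fun x => f x * g x).
Proof.
  intros [K HK] [M HM]; exists (K * M); intros x; rewrite Rabs_mult.
  apply Rmult_le_compat; auto using Rabs_pos.
Qed.

Lemma vanishing_mult (f g : R -> R) :
  vanishing f -> bounded g -> vanishing (fun x => f x * g x).
Proof.
  intros Hf [K HK] eps Heps.
  (* The added 1 keeps the divisor of [eps] positive when the bound [K] is 0. *)
  assert (HK1 : 0 < Rabs K + 1) by (pose proof (Rabs_pos K); lra).
  destruct (Hf (eps / (Rabs K + 1))) as [N HN].
  { now apply Rdiv_lt_0_compat. }
  exists N; intros x Hx; rewrite Rabs_mult.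
  replace eps with (eps / (Rabs K + 1) * (Rabs K + 1)) by (field; lra).
  apply Rmult_le_compat; try apply Rabs_pos.
  - now apply HN.
  - pose proof (HK x); pose proof (Rle_abs K); lra.
Qed.

Lemma vanishing_scal (c : R) (f : R -> R) :
  vanishing f -> vanishing (fun x => c * f x).
Proof.
  intros Hf.
  assert (H : vanishing (fun x => f x * c)).
  { apply (vanishing_mult f (fun _ => c)); [exact Hf|].
    exists (Rabs c); intros _; apply Rle_refl. }
  intros eps Heps; destruct (H eps Heps) as [N HN]; exists N; intros x Hx.
  rewrite Rmult_comm; now apply HN.
Qed.

Lemma vanishing_plus (f g : R -> R) :
  vanishing f -> vanishing g -> vanishing (fun x => f x + g x).
Proof.
  intros Hf Hg eps Heps.
  destruct (Hf (eps / 2)) as [N HN]; [lra|].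
  destruct (Hg (eps / 2)) as [M HM]; [lra|].
  exists (Rmax N M); intros x Hx.
  pose proof (Rabs_triang (f x) (g x)).
  pose proof (HN x (Rle_trans _ _ _ (Rmax_l N M) Hx)).
  pose proof (HM x (Rle_trans _ _ _ (Rmax_r N M) Hx)).
  lra.
Qed.

Lemma vanishing_ext (f g : R -> R) :
  (forall x, f x = g x) -> vanishing f -> vanishing g.
Proof.
  intros E Hf eps Heps; destruct (Hf eps Heps) as [N HN]; exists N.
  intros x Hx; rewrite <- E; now apply HN.
Qed.

(** * Functions with nonnegative derivative *)

Lemma nonneg_derivative_le (f df : R -> R) (x y : R) :
  (forall t, is_derive f t (df t)) -> (forall t, 0 <= df t) -> x <= y ->
  f x <= f y.
Proof.
  intros Hd Hp Hxy.
  destruct (MVT_gen f x y df) as [c [_ Hc]].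
  - intros t _; apply Hd.
  - intros t _; apply continuity_pt_filterlim.
    apply (ex_derive_continuous (V := R_NormedModule)).
    exists (df t); apply Hd.
  - pose proof (Rmult_le_pos (df c) (y - x) (Hp c)); lra.
Qed.

(** For large [y], monotonicity squeezes [f x] between [f (- y)] and [f y], and both of these are
    arbitrarily small. *)
Lemma monotone_vanishing_zero (f df : R -> R) :
  (forall t, is_derive f t (df t)) -> (forall t, 0 <= df t) -> vanishing f ->
  forall x, f x = 0.
Proof.
  intros Hd Hp Hv x.
  assert (H : forall eps, 0 < eps -> - eps <= f x <= eps).
  { intros eps Heps; destruct (Hv eps Heps) as [N HN].
    set (y := Rabs N + Rabs x).
    assert (Hy : N <= y /\ 0 <= y /\ - y <= x <= y).
    { unfold y; unfold Rabs; destruct (Rcase_abs N), (Rcase_abs x); lra. }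
    assert (H1 : Rabs (f y) <= eps) by (apply HN; rewrite Rabs_pos_eq; lra).
    assert (H2 : Rabs (f (- y)) <= eps)
      by (apply HN; rewrite Rabs_Ropp, Rabs_pos_eq; lra).
    apply Rabs_le_between in H1; apply Rabs_le_between in H2.
    pose proof (nonneg_derivative_le f df (- y) x Hd Hp).
    pose proof (nonneg_derivative_le f df x y Hd Hp).
    lra. }
  destruct (Rtotal_order (f x) 0) as [Hx|[Hx|Hx]]; [|exact Hx|].
  - pose proof (H (- f x / 2)); lra.
  - pose proof (H (f x / 2)); lra.
Qed.

(** * Real and imaginary parts, and the consequences of exponential decay *)

Lemma is_derivative_Re (f f' : R -> C) (x : R) :
  is_derivative f f' -> is_derive (fun t => Re (f t)) x (Re (f' x)).
Proof.
  intros H; specialize (H x); unfold is_derive in *.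
  eapply filterdiff_ext_lin.
  (* Over the reals, [C] is the product module of two copies of [R]. With this type made explicit,
     [Re] is the linear projection [fst] and the chain rule applies. *)
  - apply (filterdiff_comp' f
      (fun z : prod_NormedModule R_AbsRing R_NormedModule R_NormedModule =>
         fst z) x _ fst H).
    apply filterdiff_linear, is_linear_fst.
  - reflexivity.
Qed.

Lemma is_derivative_Im (f f' : R -> C) (x : R) :
  is_derivative f f' -> is_derive (fun t => Im (f t)) x (Im (f' x)).
Proof.
  intros H; specialize (H x); unfold is_derive in *.
  eapply filterdiff_ext_lin.
  - apply (filterdiff_comp' f
      (fun z : prod_NormedModule R_AbsRing R_NormedModule R_NormedModule =>
         snd z) x _ snd H).
    apply filterdiff_linear, is_linear_snd.
  - reflexivity.
Qed.

Lemma Re_le_Cmod (z : C) : Rabs (Re z) <= Cmod z.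
Proof. exact (Rle_trans _ _ _ (Rmax_l _ _) (Rmax_Cmod z)). Qed.

Lemma Im_le_Cmod (z : C) : Rabs (Im z) <= Cmod z.
Proof. exact (Rle_trans _ _ _ (Rmax_r _ _) (Rmax_Cmod z)). Qed.

Lemma exp_decay_bounded (f : R -> C) (g : R -> R) :
  (forall x, Rabs (g x) <= Cmod (f x)) -> exp_decay f -> bounded g.
Proof.
  intros Hg (K & th & Hth & H); exists (Rabs K); intros x.
  apply (Rle_trans _ _ _ (Hg x)), (Rle_trans _ _ _ (H x)).
  assert (E : exp (- th * Rabs x) <= 1).
  { pose proof (Rmult_le_pos th (Rabs x) (Rlt_le _ _ Hth) (Rabs_pos x)).
    pose proof (exp_ineq1_le (th * Rabs x)).
    replace (- th * Rabs x) with (- (th * Rabs x)) by ring.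
    rewrite exp_Ropp, <- Rinv_1; apply Rinv_le_contravar; lra. }
  pose proof (exp_pos (- th * Rabs x)).
  apply Rle_trans with (Rabs K * exp (- th * Rabs x)).
  - apply Rmult_le_compat_r; [lra|apply Rle_abs].
  - rewrite <- (Rmult_1_r (Rabs K)) at 2.
    apply Rmult_le_compat_l; [apply Rabs_pos|exact E].
Qed.

Lemma exp_decay_vanishing (f : R -> C) (g : R -> R) :
  (forall x, Rabs (g x) <= Cmod (f x)) -> exp_decay f -> vanishing g.
Proof.
  (* Since [exp t >= t], the bound [Rabs K <= eps * exp (th * Rabs x)] holds as soon as
     [Rabs K <= eps * (th * Rabs x)]; solving for [Rabs x] gives the threshold. *)
  intros Hg (K & th & Hth & H) eps Heps; exists (Rabs K / eps / th); intros x Hx.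
  apply (Rle_trans _ _ _ (Hg x)), (Rle_trans _ _ _ (H x)).
  assert (E : Rabs K <= eps * exp (th * Rabs x)).
  { apply Rle_trans with (eps * (th * Rabs x)).
    - replace (Rabs K) with (eps * (th * (Rabs K / eps / th))) by (field; lra).
      apply Rmult_le_compat_l; [lra|]; apply Rmult_le_compat_l; lra.
    - apply Rmult_le_compat_l; [lra|].
      pose proof (exp_ineq1_le (th * Rabs x)); lra. }
  replace (- th * Rabs x) with (- (th * Rabs x)) by ring; rewrite exp_Ropp.
  pose proof (exp_pos (th * Rabs x)).
  apply Rle_div_l; [assumption|]; pose proof (Rle_abs K); lra.
Qed.

(** * Bounds and monotonicity of the profile *)

Lemma profile_bounds (gamma mu vp : R) (v : R -> R) (x : R) :
  vp <= 1 -> is_profile gamma mu vp v -> vp <= v x <= 1.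
Proof.
  intros Hvp [[-> H]|(_ & H & _)]; [rewrite H; lra|apply H].
Qed.

Lemma profile_derivative (gamma mu vp : R) (v : R -> R) (x : R) :
  is_profile gamma mu vp v -> is_derive v x (Derive v x) /\ Derive v x <= 0.
Proof.
  intros [[_ H]|(_ & _ & Hm & Hd & _)].
  - assert (E : is_derive v x 0).
    { apply (is_derive_ext (fun _ => 1)); [now intros; rewrite H|].
      apply (is_derive_const (V := R_NormedModule)). }
    rewrite (is_derive_unique _ _ _ E); split; [exact E|lra].
  - split; [now apply Derive_correct|].
    assert (pr : derivable v) by (intros t; now apply ex_derive_Reals_0).
    rewrite <- (Derive_Reals v x (pr x)).
    apply nonpos_derivative_0; exact Hm.
Qed.

(** * The flux of a single field: its derivative and its limits *)

(* For [z = x1 + i x2] and [y = y1 + i y2], this is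
   [kappa (Re + s Im) (y conj z) - v |z|^2 / 2]. *)
Definition flux (kappa s : R) (v x1 x2 y1 y2 : R -> R) (t : R) : R :=
  kappa * (y1 t * x1 t + y2 t * x2 t + s * (y2 t * x1 t - y1 t * x2 t))
  - v t * (x1 t * x1 t + x2 t * x2 t) / 2.

(** The terms in [e1], [e2] are kept apart, since the differential equation is substituted there. In
    the second line, if [d1], [d2] are a common multiple [m] of [y1], [y2], the part with [s]
    cancels and [kappa * m * |y|^2] remains. *)
Lemma is_derive_flux (kappa s : R) (v x1 x2 y1 y2 : R -> R)
    (t dv d1 d2 e1 e2 : R) :
  is_derive v t dv -> is_derive x1 t d1 -> is_derive x2 t d2 ->
  is_derive y1 t e1 -> is_derive y2 t e2 ->
  is_derive (flux kappa s v x1 x2 y1 y2) t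
    (kappa * (e1 * x1 t + e2 * x2 t + s * (e2 * x1 t - e1 * x2 t))
     + kappa * (y1 t * d1 + y2 t * d2 + s * (y2 t * d1 - y1 t * d2))
     - dv * (x1 t * x1 t + x2 t * x2 t) / 2
     - v t * (x1 t * d1 + x2 t * d2)).
Proof.
  intros Hv H1 H2 H3 H4; unfold flux; auto_derive.
  - repeat split; eexists; eassumption.
  - apply is_derive_unique in Hv, H1, H2, H3, H4.
    (* [auto_derive] leaves eta-expanded functions, which must be contracted before the values of
       the derivatives can be rewritten. *)
    change (Derive (fun u : R => v u) t) with (Derive v t).
    change (Derive (fun u : R => x1 u) t) with (Derive x1 t).
    change (Derive (fun u : R => x2 u) t) with (Derive x2 t).
    change (Derive (fun u : R => y1 u) t) with (Derive y1 t).
    change (Derive (fun u : R => y2 u) t) with (Derive y2 t).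
    rewrite Hv, H1, H2, H3, H4; field.
Qed.

Lemma vanishing_sqr_sum (x1 x2 : R -> R) :
  vanishing x1 -> bounded x1 -> vanishing x2 -> bounded x2 ->
  vanishing (fun t => x1 t * x1 t + x2 t * x2 t).
Proof.
  intros V1 B1 V2 B2.
  now apply vanishing_plus; apply vanishing_mult.
Qed.

Lemma vanishing_flux (kappa s : R) (v x1 x2 y1 y2 : R -> R) :
  bounded v -> vanishing x1 -> bounded x1 -> vanishing x2 -> bounded x2 ->
  bounded y1 -> bounded y2 -> vanishing (flux kappa s v x1 x2 y1 y2).
Proof.
  intros Bv V1 B1 V2 B2 C1 C2.
  (* Every term contains a factor [x1] or [x2]; it is moved to the front, so that [vanishing_mult]
     asks only for boundedness of the other factor. *)
  apply (vanishing_ext (fun t =>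
    kappa * (x1 t * y1 t + x2 t * y2 t + s * (x1 t * y2 t + (-1) * (x2 t * y1 t)))
    + (- / 2) * ((x1 t * x1 t + x2 t * x2 t) * v t))).
  { intros t; unfold flux; field. }
  pose proof (vanishing_sqr_sum x1 x2 V1 B1 V2 B2).
  repeat first [ apply vanishing_plus | apply vanishing_scal
               | apply vanishing_mult; assumption ].
Qed.

(** With [x = x1 + i x2] the equations read [kappa x' = - i s x], which rotates [x] and keeps
    [|x|^2] constant; decay makes the constant 0. The factor [m] covers both [w' = y] and
    [alpha' = v p]. *)
Lemma skew_rotation_zero (kappa s : R) (m x1 x2 y1 y2 : R -> R) :
  0 < kappa -> vanishing x1 -> bounded x1 -> vanishing x2 -> bounded x2 ->
  (forall t, is_derive x1 t (m t * y1 t)) ->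
  (forall t, is_derive x2 t (m t * y2 t)) ->
  (forall t, kappa * (m t * y1 t) = s * x2 t) ->
  (forall t, kappa * (m t * y2 t) = - s * x1 t) ->
  forall t, x1 t = 0 /\ x2 t = 0.
Proof.
  intros Hk V1 B1 V2 B2 D1 D2 E1 E2 t.
  assert (Z : x1 t * x1 t + x2 t * x2 t = 0).
  { apply (monotone_vanishing_zero (fun t => x1 t * x1 t + x2 t * x2 t)
             (fun _ => 0)); [|intros; lra|now apply vanishing_sqr_sum].
    intros u; auto_derive.
    - repeat split; eexists; (exact (D1 u) || exact (D2 u)).
    - change (Derive (fun t : R => x1 t) u) with (Derive x1 u).
      change (Derive (fun t : R => x2 t) u) with (Derive x2 u).
      rewrite (is_derive_unique _ _ _ (D1 u)), (is_derive_unique _ _ _ (D2 u)).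
      apply (Rmult_eq_reg_l kappa); [|lra].
      transitivity (2 * (x1 u * (kappa * (m u * y1 u))
                         + x2 u * (kappa * (m u * y2 u)))); [ring|].
      rewrite E1, E2; ring. }
  pose proof (Rle_0_sqr (x1 t)); pose proof (Rle_0_sqr (x2 t)); unfold Rsqr in *.
  split; apply Rsqr_0_uniq; unfold Rsqr; lra.
Qed.

(** * Completing the squares *)

(* [x], [y], [a], [v p] stand for [w],
   [w'], [alpha], [alpha'], and [L] for [Re lambda + |Im lambda|]. *)
Lemma dissipation_lower_bound
    (mu mu0 sigma B k s L v dv x1 x2 y1 y2 a1 a2 p1 p2 : R) :
  0 < mu -> 0 < mu0 -> 0 < k -> sigma = mu * mu0 * (k * k) ->
  s = 1 \/ s = -1 -> 0 < v <= 1 -> dv <= 0 ->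
  / (2 * mu) + B * B * k <= L -> sigma * mu0 / 2 + B * B * k <= L ->
  / (mu * k) * (v / (2 * mu))
    * ((mu * y1 - s * x2) * (mu * y1 - s * x2)
       + (mu * y2 + s * x1) * (mu * y2 + s * x1))
  + v * (sigma * mu0) / 2
    * ((/ (sigma * mu0) * (v * p1) - s * a2) * (/ (sigma * mu0) * (v * p1) - s * a2)
       + (/ (sigma * mu0) * (v * p2) + s * a1) * (/ (sigma * mu0) * (v * p2) + s * a1))
  <=
  / (mu * k)
    * (L * v * (x1 * x1 + x2 * x2) - dv * (x1 * x1 + x2 * x2) / 2
       + s * v * (y2 * x1 - y1 * x2)
       - B / mu0 * v * (p1 * x1 + p2 * x2 + s * (p2 * x1 - p1 * x2))
       + mu * (y1 * y1 + y2 * y2))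
  + (L * v * (a1 * a1 + a2 * a2) - dv * (a1 * a1 + a2 * a2) / 2
     + s * (v * v) * (p2 * a1 - p1 * a2)
     - B * v * (y1 * a1 + y2 * a2 + s * (y2 * a1 - y1 * a2))
     + / (sigma * mu0) * v * (p1 * p1 + p2 * p2)).
Proof.
  intros Hmu Hmu0 Hk Hs Hsg Hv Hdv HL1 HL2.
  assert (Hsig : 0 < sigma) by (rewrite Hs; repeat apply Rmult_lt_0_compat; lra).
  assert (Hc : 0 < / (mu * k)) by (apply Rinv_0_lt_compat, Rmult_lt_0_compat; lra).
  assert (Hn : 0 < / (sigma * mu0))
    by (apply Rinv_0_lt_compat, Rmult_lt_0_compat; lra).
  apply Rminus_le_0.
  assert (S2 : forall u w : R, 0 <= u * u + w * w).
  { intros u w; pose proof (Rle_0_sqr u); pose proof (Rle_0_sqr w).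
    unfold Rsqr in *; lra. }
  (* One share [mu v / 2] of the coefficient of [|y|^2] serves the square of the lower bound and
     costs [1 / (2 mu)] in [L]; another absorbs the coupling through [|y - B k (1 + i s) a|^2] and
     costs [B^2 k] in the [|a|^2] terms. The coefficient of [|p|^2] is shared likewise, at costs
     [sigma mu0 / 2] and [B^2 k]. The weight [1 / (mu k)] and the value of [k] make the two coupling
     costs equal. *)
  match goal with |- 0 <= ?E => replace E with
   (/ (mu * k) * ((L - (/ (2 * mu) + B * B * k)) * v * (x1 * x1 + x2 * x2)
       + (- dv) / 2 * (x1 * x1 + x2 * x2)
       + mu * (1 - v) * (y1 * y1 + y2 * y2)
       + mu * v / 2
         * ((y1 - B * k * (a1 - s * a2)) * (y1 - B * k * (a1 - s * a2))
            + (y2 - B * k * (a2 + s * a1)) * (y2 - B * k * (a2 + s * a1))))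
    + ((L - (sigma * mu0 / 2 + B * B * k)) * v * (a1 * a1 + a2 * a2)
       + (- dv) / 2 * (a1 * a1 + a2 * a2)
       + / (sigma * mu0) * v * ((1 - v * v) / 2) * (p1 * p1 + p2 * p2)
       + / (sigma * mu0) * v / 2
         * ((p1 - B * k * mu0 * (x1 - s * x2)) * (p1 - B * k * mu0 * (x1 - s * x2))
            + (p2 - B * k * mu0 * (x2 + s * x1)) * (p2 - B * k * mu0 * (x2 + s * x1)))))
   end.
  (* The identity uses [s^2 = 1], hence the split on the sign, and [sigma = mu mu0 k^2]. *)
  2:{ clear S2; subst sigma; destruct Hsg; subst s; field; repeat split; lra. }
  assert (Hv2 : 0 <= (1 - v * v) / 2).
  { replace ((1 - v * v) / 2) with ((1 - v) * (1 + v) / 2) by field.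
    pose proof (Rmult_le_pos (1 - v) (1 + v)); lra. }
  repeat first [ apply S2 | lra | apply Rmult_le_pos | apply Rplus_le_le_0_compat ].
Qed.

(** * The two equations multiplied by [v], in real and imaginary parts and solved for their
    highest-order terms *)

Lemma eigen_velocity_component (mu mu0 B v : R) (lam w w1 w2 al1 : C) :
  mu0 <> 0 -> v <> 0 ->
  (lam * w + w1 - B * al1 / (mu0 * v) = mu * (w2 / v))%C ->
  mu * Re w2 = v * (Re lam * Re w - Im lam * Im w + Re w1) - B / mu0 * Re al1
  /\ mu * Im w2 = v * (Re lam * Im w + Im lam * Re w + Im w1) - B / mu0 * Im al1.
Proof.
  intros Hm Hv H.
  assert (Hm' : RtoC mu0 <> 0) by (intros E; now apply RtoC_inj in E).
  assert (Hv' : RtoC v <> 0) by (intros E; now apply RtoC_inj in E).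
  assert (E : (mu * w2 = v * (lam * w + w1) - RtoC (B / mu0) * al1)%C).
  { rewrite RtoC_div by assumption.
    transitivity (v * (mu * (w2 / v)))%C; [field; assumption|].
    rewrite <- H; field; auto. }
  pose proof (f_equal Re E) as E1; pose proof (f_equal Im E) as E2.
  unfold Re, Im in *; simpl in *; lra.
Qed.

Lemma eigen_magnetic_component (mu0 sigma B v : R) (lam al al1 w1 q : C) :
  mu0 <> 0 -> sigma <> 0 -> v <> 0 ->
  (lam * al + al1 - B * w1 = 1 / (sigma * mu0 * v) * q)%C ->
  / (sigma * mu0) * Re q = v * (Re lam * Re al - Im lam * Im al + Re al1 - B * Re w1)
  /\ / (sigma * mu0) * Im q
     = v * (Re lam * Im al + Im lam * Re al + Im al1 - B * Im w1).
Proof.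
  intros Hm Hs Hv H.
  assert (Hm' : RtoC mu0 <> 0) by (intros E; now apply RtoC_inj in E).
  assert (Hs' : RtoC sigma <> 0) by (intros E; now apply RtoC_inj in E).
  assert (Hv' : RtoC v <> 0) by (intros E; now apply RtoC_inj in E).
  assert (E : (RtoC (/ (sigma * mu0)) * q = v * (lam * al + al1 - B * w1))%C).
  { rewrite H, RtoC_inv, RtoC_mult; [field; auto|].
    now apply Rmult_integral_contrapositive_currified. }
  pose proof (f_equal Re E) as E1; pose proof (f_equal Im E) as E2.
  unfold Re, Im in *; simpl in *; lra.
Qed.

(** * The monotone functional along an eigenfunction *)

Theorem theorem1p9 (gamma mu mu0 sigma B vp : R) (v : R -> R) (lambda : C)
    (hgamma : 1 <= gamma) (hmu : 0 < mu) (hmu0 : 0 < mu0) (hsigma : 0 < sigma)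
    (hB : 0 <= B) (hvp : 0 < vp <= 1)
    (hv : is_profile gamma mu vp v)
    (hlambda : is_eigenvalue mu mu0 sigma B v lambda)
    (hRe : 0 <= Re lambda) :
  Re lambda + Rabs (Im lambda)
  < 1 / 2 * Rmax (1 / mu) (mu0 * sigma) + B ^ 2 * sqrt (sigma / (mu * mu0)).
Proof.
  destruct hlambda as (w & al & w1 & w2 & al1 & al2 & q & Dw & Dw1 & Dal & _ & Dq
    & Ew & Eal & Xw & Xw1 & _ & Xal & Xal1 & _ & x0 & Hx0).
  set (k := sqrt (sigma / (mu * mu0))).
  assert (Hmm : 0 < mu * mu0) by (apply Rmult_lt_0_compat; lra).
  assert (Hsm : 0 < sigma * mu0) by (apply Rmult_lt_0_compat; lra).
  assert (Hq : 0 < sigma / (mu * mu0)) by now apply Rdiv_lt_0_compat.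
  assert (Hk : 0 < k) by now apply sqrt_lt_R0.
  assert (Hkk : sigma = mu * mu0 * (k * k)).
  { unfold k; rewrite sqrt_sqrt by lra; field; lra. }
  apply Rnot_le_lt; intros HL; set (L := Re lambda + Rabs (Im lambda)) in HL.
  assert (Hs : exists s, (s = 1 \/ s = -1) /\ L = Re lambda + s * Im lambda).
  { unfold L, Rabs; destruct (Rcase_abs (Im lambda));
      [exists (-1)|exists 1]; split; auto; lra. }
  destruct Hs as (s & Hs & EL).
  assert (Hss : s * s = 1) by (destruct Hs; subst s; ring).
  assert (HL1 : / (2 * mu) + B * B * k <= L).
  { pose proof (Rmax_l (1 / mu) (mu0 * sigma)).
    replace (/ (2 * mu)) with (1 / mu / 2) by (field; lra); lra. }
  assert (HL2 : sigma * mu0 / 2 + B * B * k <= L).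
  { pose proof (Rmax_r (1 / mu) (mu0 * sigma)); lra. }
  assert (Hv : forall x, vp <= v x <= 1).
  { intros x; apply (profile_bounds gamma mu vp v x); [lra|exact hv]. }
  assert (Hv0 : forall x, v x <> 0) by (intros x; specialize (Hv x); lra).
  assert (Bv : bounded v).
  { exists 1; intros x; specialize (Hv x); rewrite Rabs_pos_eq; lra. }
  (* The positive lower bound [vp] transfers boundedness from [alpha'] to [alpha' / v]. *)
  assert (Biv : bounded (fun x => / v x)).
  { exists (/ vp); intros x; specialize (Hv x).
    rewrite Rabs_pos_eq; [apply Rinv_le_contravar; lra|].
    apply Rlt_le, Rinv_0_lt_compat; lra. }
  (* The unknown [p = alpha' / v] is used in place of [alpha'] because its derivative is exactly the
     [q] of the second equation. *)
  set (p1 := fun x => Re (al1 x / v x)%C); set (p2 := fun x => Im (al1 x / v x)%C).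
  assert (Ep1 : forall x, p1 x = Re (al1 x) * / v x).
  { intros x; unfold p1, Re; simpl; field; auto. }
  assert (Ep2 : forall x, p2 x = Im (al1 x) * / v x).
  { intros x; unfold p2, Im; simpl; field; auto. }
  assert (Fp1 : forall x, Re (al1 x) = v x * p1 x)
    by (intros x; rewrite Ep1; field; auto).
  assert (Fp2 : forall x, Im (al1 x) = v x * p2 x)
    by (intros x; rewrite Ep2; field; auto).
  assert (Vx1 := exp_decay_vanishing w _ (fun x => Re_le_Cmod (w x)) Xw).
  assert (Vx2 := exp_decay_vanishing w _ (fun x => Im_le_Cmod (w x)) Xw).
  assert (Bx1 := exp_decay_bounded w _ (fun x => Re_le_Cmod (w x)) Xw).
  assert (Bx2 := exp_decay_bounded w _ (fun x => Im_le_Cmod (w x)) Xw).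
  assert (By1 := exp_decay_bounded w1 _ (fun x => Re_le_Cmod (w1 x)) Xw1).
  assert (By2 := exp_decay_bounded w1 _ (fun x => Im_le_Cmod (w1 x)) Xw1).
  assert (Va1 := exp_decay_vanishing al _ (fun x => Re_le_Cmod (al x)) Xal).
  assert (Va2 := exp_decay_vanishing al _ (fun x => Im_le_Cmod (al x)) Xal).
  assert (Ba1 := exp_decay_bounded al _ (fun x => Re_le_Cmod (al x)) Xal).
  assert (Ba2 := exp_decay_bounded al _ (fun x => Im_le_Cmod (al x)) Xal).
  assert (Bp1 : bounded p1).
  { destruct (bounded_mult _ _
      (exp_decay_bounded al1 _ (fun x => Re_le_Cmod (al1 x)) Xal1) Biv) as [K HK].
    exists K; intros x; rewrite Ep1; apply HK. }
  assert (Bp2 : bounded p2).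
  { destruct (bounded_mult _ _
      (exp_decay_bounded al1 _ (fun x => Im_le_Cmod (al1 x)) Xal1) Biv) as [K HK].
    exists K; intros x; rewrite Ep2; apply HK. }
  assert (Da1 : forall x, is_derive (fun t => Re (al t)) x (v x * p1 x))
    by (intros x; rewrite <- Fp1; now apply is_derivative_Re).
  assert (Da2 : forall x, is_derive (fun t => Im (al t)) x (v x * p2 x))
    by (intros x; rewrite <- Fp2; now apply is_derivative_Im).
  set (x1 := fun x => Re (w x)) in *; set (x2 := fun x => Im (w x)) in *.
  set (y1 := fun x => Re (w1 x)) in *; set (y2 := fun x => Im (w1 x)) in *.
  set (a1 := fun x => Re (al x)) in *; set (a2 := fun x => Im (al x)) in *.
  set (F := fun x => / (mu * k) * flux mu s v x1 x2 y1 y2 x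
                     + flux (/ (sigma * mu0)) s v a1 a2 p1 p2 x).
  (* This is [F'] once the equations have eliminated [w''] and [q]. The real parts of the transport
     terms, [v Re (w' conj w)] and [v^2 Re (p conj alpha)], have cancelled against the derivatives
     of [- v |w|^2 / 2] and [- v |alpha|^2 / 2]; only their parts with [s] survive. *)
  set (D := fun x =>
    / (mu * k)
      * (L * v x * (x1 x * x1 x + x2 x * x2 x)
         - Derive v x * (x1 x * x1 x + x2 x * x2 x) / 2
         + s * v x * (y2 x * x1 x - y1 x * x2 x)
         - B / mu0 * v x
           * (p1 x * x1 x + p2 x * x2 x + s * (p2 x * x1 x - p1 x * x2 x))
         + mu * (y1 x * y1 x + y2 x * y2 x))
    + (L * v x * (a1 x * a1 x + a2 x * a2 x)
       - Derive v x * (a1 x * a1 x + a2 x * a2 x) / 2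
       + s * (v x * v x) * (p2 x * a1 x - p1 x * a2 x)
       - B * v x * (y1 x * a1 x + y2 x * a2 x + s * (y2 x * a1 x - y1 x * a2 x))
       + / (sigma * mu0) * v x * (p1 x * p1 x + p2 x * p2 x))).
  assert (HF : forall x, is_derive F x (D x)).
  { intros x; destruct (profile_derivative gamma mu vp v x hv) as [Dv _].
    destruct (eigen_velocity_component _ _ _ _ _ _ _ _ _
                (Rgt_not_eq _ _ hmu0) (Hv0 x) (Ew x)) as [W1 W2].
    destruct (eigen_magnetic_component _ _ _ _ _ _ _ _ _
      (Rgt_not_eq _ _ hmu0) (Rgt_not_eq _ _ hsigma) (Hv0 x) (Eal x)) as [A1 A2].
    rewrite Fp1 in W1, A1; rewrite Fp2 in W2, A2.
    pose proof (is_derive_flux mu s v x1 x2 y1 y2 x _ _ _ _ _ Dv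
      (is_derivative_Re _ _ x Dw) (is_derivative_Im _ _ x Dw)
      (is_derivative_Re _ _ x Dw1) (is_derivative_Im _ _ x Dw1)) as G1.
    pose proof (is_derive_flux (/ (sigma * mu0)) s v a1 a2 p1 p2 x _ _ _ _ _ Dv
      (Da1 x) (Da2 x)
      (is_derivative_Re _ _ x Dq) (is_derivative_Im _ _ x Dq)) as G2.
    evar_last.
    - apply (is_derive_plus (V := R_NormedModule)); [|exact G2].
      apply is_derive_scal; exact G1.
    - unfold plus; simpl; unfold D.
      fold (x1 x) (x2 x) (y1 x) (y2 x) (a1 x) (a2 x) in *.
      apply f_equal2; [apply f_equal|].
      (* Grouping by [Re w''] and [Im w''] lets the equation be substituted; its [lambda] terms then
         combine to [(Re lambda + s Im lambda) v |w|^2 = L v |w|^2]. *)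
      + transitivity ((mu * Re (w2 x)) * (x1 x - s * x2 x)
          + (mu * Im (w2 x)) * (x2 x + s * x1 x)
          + mu * (y1 x * y1 x + y2 x * y2 x)
          - Derive v x * (x1 x * x1 x + x2 x * x2 x) / 2
          - v x * (x1 x * y1 x + x2 x * y2 x)); [unfold y1, y2; ring|].
        rewrite W1, W2, EL; unfold x1, x2, y1, y2; destruct Hs; subst s; field; lra.
      + transitivity ((/ (sigma * mu0) * Re (q x)) * (a1 x - s * a2 x)
          + (/ (sigma * mu0) * Im (q x)) * (a2 x + s * a1 x)
          + / (sigma * mu0) * v x * (p1 x * p1 x + p2 x * p2 x)
          - Derive v x * (a1 x * a1 x + a2 x * a2 x) / 2
          - v x * v x * (a1 x * p1 x + a2 x * p2 x)); [field; lra|].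
        rewrite A1, A2, EL; unfold a1, a2, y1, y2; destruct Hs; subst s; field; lra. }
  assert (HD := fun x => dissipation_lower_bound mu mu0 sigma B k s L (v x)
    (Derive v x) (x1 x) (x2 x) (y1 x) (y2 x) (a1 x) (a2 x) (p1 x) (p2 x)
    hmu hmu0 Hk Hkk Hs
    (conj (Rlt_le_trans _ _ _ (proj1 hvp) (proj1 (Hv x))) (proj2 (Hv x)))
    (proj2 (profile_derivative gamma mu vp v x hv)) HL1 HL2).
  assert (Hc1 : forall x, 0 < / (mu * k) * (v x / (2 * mu))).
  { intros x; specialize (Hv x); apply Rmult_lt_0_compat.
    - apply Rinv_0_lt_compat, Rmult_lt_0_compat; lra.
    - apply Rdiv_lt_0_compat; lra. }
  assert (Hc2 : forall x, 0 < v x * (sigma * mu0) / 2).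
  { intros x; specialize (Hv x).
    pose proof (Rmult_lt_0_compat (v x) (sigma * mu0)); lra. }
  assert (S2 : forall a b : R, 0 <= a * a + b * b).
  { intros a b; pose proof (Rle_0_sqr a); pose proof (Rle_0_sqr b).
    unfold Rsqr in *; lra. }
  assert (S0 : forall a b : R, a * a + b * b = 0 -> a = 0 /\ b = 0).
  { intros a b H; pose proof (Rle_0_sqr a); pose proof (Rle_0_sqr b).
    unfold Rsqr in *; split; apply Rsqr_0_uniq; unfold Rsqr; lra. }
  assert (D_pos : forall x, 0 <= D x).
  { intros x; refine (Rle_trans _ _ _ _ (HD x)).
    apply Rplus_le_le_0_compat; apply Rmult_le_pos; auto using Rlt_le. }
  assert (F0 : forall x, F x = 0).
  { apply (monotone_vanishing_zero F D HF D_pos).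
    apply vanishing_plus; [apply vanishing_scal|]; now apply vanishing_flux. }
  assert (D0 : forall x, D x = 0).
  { intros x; rewrite <- (is_derive_unique F x (D x) (HF x)).
    rewrite (Derive_ext F (fun _ => 0) x F0); apply Derive_const. }
  assert (Sq : forall x,
    (mu * y1 x - s * x2 x = 0 /\ mu * y2 x + s * x1 x = 0)
    /\ (/ (sigma * mu0) * (v x * p1 x) - s * a2 x = 0
        /\ / (sigma * mu0) * (v x * p2 x) + s * a1 x = 0)).
  (* As [D x = 0], two nonnegative terms have sum at most 0; their weights are strictly positive, so
     each square vanishes. *)
  { intros x; pose proof (HD x) as H; fold (D x) in H; rewrite D0 in H.
    match type of H with ?c * (?a * ?a + ?b * ?b) + ?d * (?e * ?e + ?f * ?f) <= 0 =>
      pose proof (Rmult_le_pos c _ (Rlt_le _ _ (Hc1 x)) (S2 a b));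
      pose proof (Rmult_le_pos d _ (Rlt_le _ _ (Hc2 x)) (S2 e f));
      split; apply S0;
      [apply (Rmult_eq_reg_l c)|apply (Rmult_eq_reg_l d)]
    end; try lra; apply Rgt_not_eq; [apply Hc1|apply Hc2]. }
  assert (W0 : forall t, x1 t = 0 /\ x2 t = 0).
  (* The vanishing squares say [mu w' = - i s w] here, and [alpha' / (sigma mu0) = - i s alpha] for
     the second field. *)
  { apply (skew_rotation_zero mu s (fun _ => 1) x1 x2 y1 y2); auto.
    - intros t; rewrite Rmult_1_l; now apply is_derivative_Re.
    - intros t; rewrite Rmult_1_l; now apply is_derivative_Im.
    - intros t; destruct (Sq t); lra.
    - intros t; destruct (Sq t); lra. }
  assert (A0 : forall t, a1 t = 0 /\ a2 t = 0).
  { apply (skew_rotation_zero (/ (sigma * mu0)) s v a1 a2 p1 p2); auto.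
    - now apply Rinv_0_lt_compat.
    - intros t; destruct (Sq t); lra.
    - intros t; destruct (Sq t); lra. }
  destruct (W0 x0) as [E1 E2], (A0 x0) as [E3 E4].
  destruct Hx0 as [H|H]; apply H; apply injective_projections; assumption.
Qed.
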